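(* Assume that there is $\bar\mu\ge1$ with $\mu_h\le\bar\mu$ for all $h$, that $I:V_1\to W$ and $C:Q\to V_2^*$ are compact, and that $\lim_{h\to0}\inf_{v_h\in V_h}\|v-v_h\|=0$ for every $v\in V$. Then the quasi-best-approximation constant $\nu_h$ of the variational discretization satisfies $$\nu_h=\mu_h\big(1+\bar\kappa\,o(1)\big)\quad\text{as } h\to0,$$ where $$\bar\kappa=\frac{1+2L}{1+L}\left(1+M\left(1+\frac{2M}{\sqrt{\alpha}}\right)\bar\mu\right),\qquad L=\frac{M}{\sqrt{\alpha}},$$ and $o(1)$ denotes a quantity that tends to $0$ as $h\to0$ at a rate independent of $\alpha$.
   Context: Let $Q, W, V_1, V_2$ be real Hilbert spaces with norms $\|\cdot\|_Q,\|\cdot\|_W,\|\cdot\|_1,\|\cdot\|_2$; $\langle\cdot,\cdot\rangle_i$ denotes the duality pairing of $V_i^*$ and $V_i$. Let $a:V_1\times V_2\to\mathbb{R}$ be a bounded bilinear form such that, for all $v_1\in V_1$, if $a(v_1,v_2)=0$ for all $v_2\in V_2$, then $v_1=0$, and $\inf_{\|v_2\|_2=1}\sup_{\|v_1\|_1=1}a(v_1,v_2)>0$. The norm of $V_2$ is (after replacing it, if necessary, by an equivalent one) $\|v_2\|_2=\sup_{\varphi_1\in V_1,\ \|\varphi_1\|_1=1}a(\varphi_1,v_2)$, so that the continuity and inf-sup constants of $a$ are both $1$. Let $C:Q\to V_2^*$ and $I:V_1\to W$ be bounded linear operators with operator norms $M_C$ and $M_I$ (with respect to these norms), $C^*:V_2\to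 Q$ given by $(q,C^*v_2)_Q=\langle Cq,v_2\rangle_2$, and $M:=\max\{M_I,M_C\}$. Let $\alpha>0$. Set $V:=V_1\times V_2$ with $\|v\|:=(\|v_1\|_1^2+\|v_2\|_2^2)^{1/2}$ and $$b(v,\varphi) := a(v_1,\varphi_2)+a(\varphi_1,v_2)+\tfrac{1}{\sqrt{\alpha}}\big[(C^*v_2,C^*\varphi_2)_Q-(Iv_1,I\varphi_1)_W\big],\quad v,\varphi\in V.$$ Let $h$ range over a sequence of positive numbers tending to $0$. For each $h$, let $V_{h,i}\subset V_i$, $i=1,2$, be finite-dimensional subspaces (not depending on $\alpha$) such that the restriction of $a$ to $V_{h,1}\times V_{h,2}$ is nondegenerate (no nonzero element of either space is annihilated by the whole other space), and $V_h:=V_{h,1}\times V_{h,2}$. The generalized Ritz projection $R_{h,1}:V_1\to V_{h,1}$ is given by $a(R_{h,1}v_1,\varphi_{h,2})=a(v_1,\varphi_{h,2})$ for all $\varphi_{h,2}\in V_{h,2}$. The quasi-best-approximation constant $\mu_h$ of the constraint discretization is the smallest number $\mu_h\ge1$ such that $\|v_1-R_{h,1}v_1\|_1\le\mu_h\inf_{v_{h,1}\in V_{h,1}}\|v_1-v_{h,1}\|_1$ for all $v_1\in V_1$. The quasi-best-approximation constant $\nu_h$ of the variational discretization is the smallest number $\nu_h\ge1$ such that $\|v-G_hv\|\le\nu_h\inf_{v_h\in V_h}\|v-v_h\|$ for all $v\in V$, where $G_hv\in V_h$ is the (unique) Galerkin approximation given by $b(G_hv,\varphi_h)=b(v,\varphi_h)$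 for all $\varphi_h\in V_h$. *)

(* Defs.v *)
From HB Require Import structures.
From mathcomp Require Import all_boot all_order all_algebra.
From mathcomp Require Import all_classical all_reals all_analysis.

Set Implicit Arguments.
Unset Strict Implicit.
Unset Printing Implicit Defensive.

Import Order.TTheory GRing.Theory Num.Theory.
Import numFieldNormedType.Exports.

Local Open Scope classical_set_scope.
Local Open Scope ring_scope.

HB.mixin Record NormedModule_isHilbert (R : realType) V
    & NormedModule R V := {
  inner : {dot V for @idfun R};
  inner_normE : forall x : V, inner x x = `|x| ^+ 2
}.

#[short(type="hilbertType")]
HB.structure Definition Hilbert (R : realType) :=
  {V of CompleteNormedModule R V & NormedModule_isHilbert R V}.

Definition unit_sphere (R : realType) (V : normedModType R) : set V :=
  [set v | `|v| = 1].
Arguments unit_sphere {R} V.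

Section bounded_operators.
Context {R : realType} {V W : normedModType R}.

Definition bounded_op (f : V -> W) := exists K : R, forall x, `|f x| <= K * `|x|.

(* The closed unit ball is used, not the sphere, so that the supremum is taken
   over a nonempty set (and is 0) when V is trivial. *)
Definition opnorm (f : V -> W) : R :=
  sup [set `|f x| | x in [set x : V | `|x| <= 1]].

Definition compact_op (f : V -> W) :=
  forall B : set V, bounded_set B -> precompact (f @` B).

Lemma opnorm_has_sup (f : V -> W) : bounded_op f ->
  has_sup [set `|f x| | x in [set x : V | `|x| <= 1]].
Proof.
move=> [K fK]; split; first by exists `|f 0|, 0 => //=; rewrite normr0.
exists (Num.max K 0) => _ [x /= x1 <-]; apply: (le_trans (fK x)).
apply: (@le_trans _ _ (Num.max K 0 * `|x|)).
  by rewrite ler_wpM2r// le_max lexx.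
by rewrite ler_piMr// le_max lexx orbT.
Qed.

Lemma opnorm_ge (f : V -> W) x : bounded_op f -> `|x| <= 1 ->
  `|f x| <= opnorm f.
Proof.
by move=> bf x1; apply: ub_le_sup; [case: (opnorm_has_sup bf)|exists x].
Qed.

Lemma opnorm_le (f : V -> W) c :
  (forall x, `|x| <= 1 -> `|f x| <= c) -> opnorm f <= c.
Proof.
move=> H; apply: ge_sup; first by exists `|f 0|, 0 => //=; rewrite normr0.
by move=> _ [x x1 <-]; exact: H.
Qed.

Lemma opnorm_ge0 (f : V -> W) : bounded_op f -> 0 <= opnorm f.
Proof.
by move=> bf; apply: (le_trans _ (opnorm_ge (x := 0) bf _)); rewrite ?normr0.
Qed.

End bounded_operators.

Section dual_pred.
Context {R : realType} (V : normedModType R).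

Definition dual_pred : {pred V -> R} :=
  mem [set f : V -> R | scalar f /\ bounded_op f].
Definition dual_key : pred_key dual_pred. Proof. exact. Qed.
Canonical dual_keyed := KeyedPred dual_key.

Lemma dual_submod_closed : submod_closed dual_pred.
Proof.
split=> [|k f g].
  rewrite inE; split=> [c x y|]; first by rewrite mulr0 addr0.
  by exists 0 => x; rewrite mul0r normr0.
rewrite !inE => -[lf [Kf bf]] [lg [Kg bg]]; split=> [c x y|].
  by rewrite !fctE lf lg [LHS](_ : _ = c * (k *: f x + g x) + (k *: f y + g y))//;
    rewrite /GRing.scale/= !mulrDr !mulrA [k * c]mulrC addrACA.
exists (`|k| * Kf + Kg) => x; rewrite !fctE (le_trans (ler_normD _ _))//.
by rewrite mulrDl lerD// normrM -mulrA ler_wpM2l.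
Qed.

HB.instance Definition _ := GRing.isSubmodClosed.Build R (V -> R) dual_pred
  dual_submod_closed.

End dual_pred.
Arguments dual_pred {R} V.

Record dual (R : realType) (V : normedModType R) := Dual {
  dual_fun :> V -> R;
  _ : dual_fun \in dual_pred V
}.

Section dual_normed.
Context {R : realType} (V : normedModType R).

HB.instance Definition _ := [isSub for @dual_fun R V].
HB.instance Definition _ := [Choice of dual V by <:].
HB.instance Definition _ := [SubChoice_isSubLmodule of dual V by <:].

Implicit Types f g : dual V.

Lemma dual_scalar f : scalar f.
Proof. by case: f => f /= /[!inE] -[]. Qed.

Lemma dual_bounded f : bounded_op f.
Proof. by case: f => f /= /[!inE] -[]. Qed.

Lemma dual_normD f g : opnorm (f + g : dual V) <= opnorm f + opnorm g.
Proof.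
apply: opnorm_le => x x1; apply: (le_trans (ler_normD (f x) (g x))).
by apply: lerD; apply: opnorm_ge x1; exact: dual_bounded.
Qed.

Lemma dual_normZ_le (l : R) f : opnorm (l *: f : dual V) <= `|l| * opnorm f.
Proof.
apply: opnorm_le => x x1; rewrite [`|_|]normrM ler_wpM2l//.
by apply: opnorm_ge x1; exact: dual_bounded.
Qed.

Lemma dual_normZ (l : R) f : opnorm (l *: f : dual V) = `|l| * opnorm f.
Proof.
apply/eqP; rewrite eq_le dual_normZ_le/=.
have [->|l0] := eqVneq l 0.
  by rewrite normr0 mul0r; apply: opnorm_ge0; exact: (dual_bounded (0 *: f)).
rewrite -ler_pdivlMl ?normr_gt0// -normfV.
by rewrite -{1}(scalerK l0 f) dual_normZ_le.
Qed.

Lemma dual_norm0_eq0 f : opnorm f = 0 -> f = 0.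
Proof.
move=> f0; apply: val_inj; apply/funext => x /=.
have fZ (c : R) y : f (c *: y) = c * f y.
  have f00 : f 0 = 0.
    by have := dual_scalar f 1 0 0; rewrite scaler0 addr0 mul1r => /eqP;
      rewrite -subr_eq0 opprD addNKr oppr_eq0 => /eqP.
  by have := dual_scalar f c y 0; rewrite f00 !addr0.
have [->|x0] := eqVneq x 0; first by rewrite -(scale0r 0) fZ mul0r.
have : `|f (`|x|^-1 *: x)| <= 0.
  rewrite -f0; apply: opnorm_ge; first exact: dual_bounded.
  by rewrite normrZ normfV normr_id mulVf// normr_eq0.
rewrite fZ normr_le0 mulf_eq0 invr_eq0 normr_eq0 (negbTE x0)/=.
by move=> /eqP.
Qed.

HB.instance Definition _ := Lmodule_isNormed.Build R (dual V)
  dual_normD dual_normZ dual_norm0_eq0.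

End dual_normed.

Definition findim_subspace (R : realType) (V : lmodType R) (A : set V) :=
  exists (n : nat) (e : 'I_n -> V),
    A = range (fun c : 'I_n -> R => \sum_(i < n) c i *: e i).

Section quasi_best_approximation.
Context {R : realType} {V : zmodType}.
Implicit Types (N : V -> R) (A : set V) (P : V -> V).

Definition best_error N A (v : V) : R := inf [set N (v - w) | w in A].

Definition qba_bounds N A P : set R :=
  [set m | 1 <= m /\ forall v, N (v - P v) <= m * best_error N A v].

(* Outside the degenerate case where no smallest bound exists, xget returns it;
   likewise below for the elements defined by variational equations. *)
Definition qba_const N A P : R :=
  xget 0 [set m | qba_bounds N A P m /\ lbound (qba_bounds N A P) m].

End quasi_best_approximation.

Section saddle_point.
Context {R : realType} {Q W V1 V2 : hilbertType R}.
Implicit Types (a : V1 -> V2 -> R) (Cs : V2 -> Q) (I : V1 -> W).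

(* The norm of the Hilbert space V1 x V2; the library's norm on product types
   is the maximum norm. *)
Definition prod_norm (v : V1 * V2) : R := Num.sqrt (`|v.1| ^+ 2 + `|v.2| ^+ 2).

Definition saddle_form a Cs I (alpha : R) (v phi : V1 * V2) : R :=
  a v.1 phi.2 + a phi.1 v.2
  + (Num.sqrt alpha)^-1
    * (inner (Cs v.2) (Cs phi.2) - inner (I v.1) (I phi.1)).

Definition nondegenerate_on a (A1 : set V1) (A2 : set V2) :=
  (forall v1, A1 v1 -> (forall v2, A2 v2 -> a v1 v2 = 0) -> v1 = 0) /\
  (forall v2, A2 v2 -> (forall v1, A1 v1 -> a v1 v2 = 0) -> v2 = 0).

Definition ritz1 a (A1 : set V1) (A2 : set V2) (v1 : V1) : V1 :=
  xget 0 [set r | A1 r /\ forall phi2, A2 phi2 -> a r phi2 = a v1 phi2].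

Definition galerkin (b : V1 * V2 -> V1 * V2 -> R) (A : set (V1 * V2))
    (v : V1 * V2) : V1 * V2 :=
  xget (0, 0) [set g | A g /\ forall phi, A phi -> b g phi = b v phi].

Definition mu_const a (A1 : set V1) (A2 : set V2) : R := qba_const Num.norm A1 (ritz1 a A1 A2).

Definition nu_const a Cs I (alpha : R) (A1 : set V1) (A2 : set V2) : R :=
  qba_const prod_norm (A1 `*` A2)
    (galerkin (saddle_form a Cs I alpha) (A1 `*` A2)).

End saddle_point.

Definition kappa_bar (R : realType) (M mubar alpha : R) : R :=
  let L := M / Num.sqrt alpha in
  (1 + 2 * L) / (1 + L) * (1 + M * (1 + 2 * M / Num.sqrt alpha) * mubar).

(* Main.v *)
(** Write [R] for the pair of Ritz projections, [G] for the Galerkin projection,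
    [r := v - R v] and [v - G v = r + d], so that [d] is discrete.  Testing the
    Galerkin equation for [d] with [(-d1, d2)] bounds the seminorm
    [|I d1| + |C* d2|] by that of [r], and duality then gives
    [|d| <= 4 (M / sqrt alpha) (1 + mu) (|I r1| + |C* r2|)].  Since [r1] and [r2]
    annihilate discrete spaces that become dense and [I], [C] are compact,
    [|I r1| + |C* r2| <= eps |r|] with [eps -> 0] independent of [alpha].
    As [|r| <= mu |v - w|] for all discrete [w], the two constants [mu] and [nu]
    differ by at most a factor [1 +- delta] with
    [delta = 4 (M / sqrt alpha) (1 + mu) eps <= (4 / M) eps kappa_bar]. *)

From HB Require Import structures.
Require Import Defs.
From mathcomp Require Import all_boot all_order all_algebra.
From mathcomp Require Import all_classical all_reals all_analysis.
From mathcomp Require Import ring lra.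
Import Order.TTheory GRing.Theory Num.Theory.
Import numFieldNormedType.Exports.
Local Open Scope classical_set_scope.
Local Open Scope ring_scope.

Set Implicit Arguments.

(** * Hilbert space geometry and the Riesz representation theorem *)

Section hilbert.
Context {R : realType} {V : hilbertType R}.
Implicit Types x y z : V.

Lemma innerC x y : inner x y = inner y x.
Proof. by rewrite hermC /= expr0 mul1r. Qed.

Lemma innerZl (c : R) x y : inner (c *: x) y = c * inner x y.
Proof. by rewrite linearZl_LR. Qed.

Lemma innerZr (c : R) x y : inner x (c *: y) = c * inner x y.
Proof. by rewrite linearZr_LR. Qed.

Lemma sqr_normD x y : `|x + y| ^+ 2 = `|x| ^+ 2 + 2 * inner x y + `|y| ^+ 2.
Proof.
rewrite -!inner_normE linearDl !linearDr /= (innerC y x); ring.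
Qed.

Lemma sqr_normZ (c : R) x : `|c *: x| ^+ 2 = c ^+ 2 * `|x| ^+ 2.
Proof. by rewrite normrZ exprMn real_normK ?num_real. Qed.

Lemma sqr_normB x y : `|x - y| ^+ 2 = `|x| ^+ 2 - 2 * inner x y + `|y| ^+ 2.
Proof. by rewrite sqr_normD normrN linearNr /=; ring. Qed.

(** Cauchy-Schwarz: the squared norm of [|y|^2 x - <x, y> y] is nonnegative and equals
    [|y|^2 (|x|^2 |y|^2 - <x, y>^2)]. *)
Lemma inner_le_norm x y : `|inner x y| <= `|x| * `|y|.
Proof.
have [->|y0] := eqVneq y 0; first by rewrite linear0r !normr0 mulr0.
have yp : 0 < `|y| ^+ 2 by rewrite exprn_gt0// normr_gt0.
rewrite -(@ler_pXn2r _ 2)// ?nnegrE// ?mulr_ge0// real_normK ?num_real//.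
have : 0 <= `|(`|y| ^+ 2) *: x - (inner x y) *: y| ^+ 2 by rewrite exprn_ge0.
rewrite sqr_normB !sqr_normZ innerZl innerZr.
rewrite [(`|x| * _) ^+ 2]exprMn.
set p := `|y| ^+ 2; set q := `|x| ^+ 2; set c := inner x y => H.
have {}H : 0 <= p * (q * p - c ^+ 2) by move: H; congr (_ <= _); ring.
by move: H; rewrite pmulr_rge0// subr_ge0.
Qed.

Lemma inner_eqP x y : (forall z, inner x z = inner y z) -> x = y.
Proof.
move=> H; apply/eqP; rewrite -subr_eq0 -normr_eq0 -sqrf_eq0 -inner_normE.
by rewrite {1}linearBl /= H subrr.
Qed.

(** Variational proof: a minimizing sequence of the quadratic functional [J x = |x|^2 - 2 f x] is
    Cauchy, and its limit represents [f] because the Euler equation of [J] holds approximately along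
    the sequence. *)
Lemma riesz (f : V -> R) : scalar f -> bounded_op f ->
  exists x, forall y, inner x y = f y.
Proof.
move=> lf [K0 fK0]; pose K := Num.max K0 0.
have fK x : `|f x| <= K * `|x|.
  by apply: (le_trans (fK0 x)); rewrite ler_wpM2r// le_max lexx.
pose f' : {scalar V} := HB.pack f (GRing.isLinear.Build R V R _ f lf).
have fD x y : f (x + y) = f x + f y by exact: (linearD f').
have fZ c x : f (c *: x) = c * f x by exact: (linearZ_LR f').
have f0 : f 0 = 0 by exact: (linear0 f').
pose J x : R := `|x| ^+ 2 - 2 * f x.
have Jlb x : - K ^+ 2 <= J x.
  have := fK x; have : f x <= `|f x| := ler_norm _.
  have := sqr_ge0 (`|x| - K); rewrite /J; nra.
pose m := inf (range J).
have Jinf : has_inf (range J).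
  split; first by exists (J 0), 0.
  by exists (- K ^+ 2) => _ [x _ <-].
have mJ x : m <= J x by apply: ge_inf; [case: Jinf|exists x].
have [u Ju] : {u : nat -> V & forall n, J (u n) < m + n.+1%:R^-1}.
  apply: (@choice _ _ (fun n x => J x < m + n.+1%:R^-1)) => n.
  have n0 : 0 < n.+1%:R^-1 :> R by rewrite invr_gt0 ltr0n.
  by have [_ [x _ <-] ?] := inf_adherent n0 Jinf; exists x.
(* Parallelogram identity, with [J] at the midpoint of [x] and [y] bounded below by [m]. *)
have Jpar x y : `|x - y| ^+ 2 <= 2 * (J x - m) + 2 * (J y - m).
  have := mJ (2^-1 *: (x + y)).
  by rewrite /J sqr_normZ fZ sqr_normB sqr_normD fD; lra.
have invn_lt (e : R) : 0 < e -> \forall n \near \oo, n.+1%:R^-1 < e.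
  move=> e0; have /cvgrPdist_lt/(_ e e0) := @cvg_harmonic R.
  by apply: filterS => n; rewrite /harmonic/= sub0r normrN ger0_norm.
have /cauchy_cvgP/cvg_ex [l ul] : cauchy (u @ \oo).
  apply: cauchy_exP => e e0.
  have [N _ HN] : \forall n \near \oo, n.+1%:R^-1 < e ^+ 2 / 4.
    by apply: invn_lt; rewrite divr_gt0// exprn_gt0.
  exists (u N); exists N => // n /= Nn; rewrite -ball_normE/=.
  rewrite -(@ltr_pXn2r _ 2)// ?nnegrE ?(ltW e0)//.
  apply: (le_lt_trans (Jpar _ _)).
  have hN : N.+1%:R^-1 < e ^+ 2 / 4 := HN N (leqnn N).
  have hn : n.+1%:R^-1 < e ^+ 2 / 4 := HN n Nn.
  have := Ju N; have := Ju n; move: hN hn.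
  by move: (n.+1%:R^-1 : R) (N.+1%:R^-1 : R) (e ^+ 2) => *; lra.
exists l => y; apply/eqP; rewrite -subr_eq0 -normr_le0; apply/ler_addgt0Pl => /= e e0.
rewrite addr0.
(* Minimizing [J] along the line [u n + t y] gives [t = - c / |y|^2] and lowers [J] by
   [c^2 / |y|^2]; as [J (u n)] exceeds the infimum by less than [1 / (n + 1)], so does this decrease
   stay below it. *)
have cn n : (inner (u n) y - f y) ^+ 2 <= `|y| ^+ 2 * n.+1%:R^-1.
  set c := _ - _.
  have [y0|y0] := eqVneq y 0.
    by rewrite /c y0 linear0r f0 subr0 normr0 expr0n mul0r.
  have yp : 0 < `|y| ^+ 2 by rewrite exprn_gt0// normr_gt0.
  pose t := - c / `|y| ^+ 2.
  have ct : c ^+ 2 / `|y| ^+ 2 = - (2 * t * c + t ^+ 2 * `|y| ^+ 2).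
    by rewrite /t; field; rewrite gt_eqF// normr_gt0.
  have := mJ (u n + t *: y); have := Ju n.
  rewrite /J sqr_normD sqr_normZ innerZr fD fZ => h1 h2.
  rewrite mulrC -ler_pdivrMr// ct {ct}.
  rewrite /c; clearbody t c; move: h1 h2.
  move: (`|u n| ^+ 2 : R) (`|y| ^+ 2 : R) (n.+1%:R^-1 : R) => *; lra.
(* The choice ensures [g |y| <= e / 2]; the added 1 keeps the denominator positive when [y = 0]. *)
pose g := e / 2 / (`|y| + 1).
have y1 : 0 < `|y| + 1 by rewrite ltr_wpDl.
have g0 : 0 < g by rewrite !divr_gt0.
have /cvgrPdist_lt/(_ g g0) ulg := ul.
near \oo => n.
have h1 : `|l - u n| < g by near: n.
have h2 : n.+1%:R^-1 < g ^+ 2 by near: n; apply: invn_lt; rewrite exprn_gt0.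
have -> : inner l y - f y = inner (l - u n) y + (inner (u n) y - f y).
  by rewrite linearBl /=; ring.
have gy : g * `|y| <= e / 2.
  by rewrite /g -mulrA ler_piMr ?divr_ge0 ?(ltW e0)// mulrC ler_pdivrMr ?mul1r// lerDl.
rewrite (splitr e) (le_trans (ler_normD _ _))// lerD//.
  by rewrite (le_trans (inner_le_norm _ _))// (le_trans _ gy)// ler_wpM2r// ltW.
rewrite (le_trans _ gy)//.
rewrite -(@ler_pXn2r _ 2)// ?nnegrE ?mulr_ge0 ?(ltW g0) ?(ltW e0)//.
rewrite real_normK ?num_real// (le_trans (cn n))// exprMn mulrC.
by rewrite ler_wpM2r ?exprn_ge0//; exact: ltW.
Unshelve. all: by end_near. Qed.

End hilbert.

(** * Operator bounds, finite nets, and finite-dimensional variational problems *)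

Section normed_spaces.
Context {R : realType}.

Lemma opnorm_bound (V W : normedModType R) (f : V -> W) : scalable f ->
  bounded_op f -> forall x, `|f x| <= opnorm f * `|x|.
Proof.
move=> fZ bf x; have [->|x0] := eqVneq x 0.
  by rewrite -[X in f X](scale0r 0) fZ scale0r !normr0 mulr0.
have xp : 0 < `|x| by rewrite normr_gt0.
have : `|f (`|x|^-1 *: x)| <= opnorm f.
  apply: opnorm_ge => //.
  by rewrite normrZ normfV normr_id mulVf// gt_eqF.
by rewrite fZ normrZ normfV normr_id mulrC ler_pdivrMr.
Qed.

Lemma dual_bound (V : normedModType R) (f : dual V) x : `|f x| <= `|f| * `|x|.
Proof.
apply: (opnorm_bound (f := f)) x; last exact: dual_bounded.
pose f' : {scalar V} :=
  HB.pack (f : V -> R) (GRing.isLinear.Build R V R _ f (dual_scalar f)).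
by move=> c y; exact: (linearZ_LR f').
Qed.

Lemma precompact_net (V : normedModType R) (C : set V) (e : R) :
  precompact C -> 0 < e ->
  exists s : seq V, forall y, C y -> exists2 z, z \in s & `|y - z| < e.
Proof.
rewrite precompactE compact_cover => cC e0.
have [D _ CD] : finite_subset_cover setT (fun z : V => ball z e) (closure C).
  apply: cC => [z _|y _]; first exact: ball_open.
  by exists y => //; exact: ballxx.
exists (finmap.enum_fset D) => y /subset_closure/CD [z /= zD yz].
by exists z => //; move: yz; rewrite -ball_normE /= distrC.
Qed.

(** Linear algebra on the matrix [G] of [B] in the generating families: the row of values of [l]
    lies in the row space of [G] as soon as it kills the cokernel of [G]. The families may be
    linearly dependent, hence the pseudo-inverse. The constant [K] is chosen before [l], so the
    bound on [u] is uniform in [l]. *)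
Lemma findim_solve (U V : normedModType R) (B : U -> V -> R)
  (A1 : set U) (A2 : set V) :
  (forall v, scalar (B^~ v)) -> (forall u, scalar (B u)) ->
  findim_subspace A1 -> findim_subspace A2 ->
  (forall v, A2 v -> (forall u, A1 u -> B u v = 0) -> v = 0) ->
  exists2 K, 0 <= K & forall l : V -> R, scalar l ->
    exists u, [/\ A1 u, forall v, A2 v -> B u v = l v &
      forall c, (forall v, `|l v| <= c * `|v|) -> `|u| <= K * c].
Proof.
move=> Bl Br [n [e ->]] [m [f ->]] Bnd.
pose Bv v : {scalar U} := HB.pack (B^~ v) (GRing.isLinear.Build R U R _ _ (Bl v)).
pose Bu u : {scalar V} := HB.pack (B u) (GRing.isLinear.Build R V R _ _ (Br u)).
have Bsum u v : B (\sum_i u i *: e i) (\sum_j v j *: f j) =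
    \sum_i u i * \sum_j B (e i) (f j) * v j.
  rewrite [LHS](linear_sum (Bv (\sum_j v j *: f j))); apply: eq_bigr => i _.
  rewrite linearZ_LR /= [X in _ * X](linear_sum (Bu (e i))); congr (_ * _).
  by apply: eq_bigr => j _; rewrite linearZ_LR /= mulrC.
pose G : 'M[R]_(n, m) := \matrix_(i, j) B (e i) (f j).
pose P := pinvmx G.
(* Triangle inequality applied to the solution, whose coefficients are [\sum_j l (f j) * P j i]. *)
exists (\sum_i \sum_j `|f j| * `|P j i| * `|e i|).
  by apply: sumr_ge0 => i _; apply: sumr_ge0 => j _; rewrite !mulr_ge0.
move=> l0 ll; pose l : {scalar V} := HB.pack l0 (GRing.isLinear.Build R V R _ _ ll).
pose x : 'rV[R]_m := \row_j l (f j).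
have xG : (x <= G)%MS.
  rewrite submxE; apply/eqP/rowP => k; rewrite !mxE.
  (* A column of the cokernel, read as coefficients, gives an element of [A2] annihilated by all of
     [A1], hence 0 by nondegeneracy. *)
  pose v := \sum_j cokermx G j k *: f j.
  transitivity (l v).
    rewrite linear_sum; apply: eq_bigr => j _.
    by rewrite linearZ_LR /= !mxE mulrC.
  suff -> : v = 0 by rewrite linear0.
  apply: Bnd => [|_ [u _ <-]]; first by exists (fun j => cokermx G j k).
  rewrite Bsum big1// => i _.
  suff -> : \sum_j B (e i) (f j) * cokermx G j k = (G *m cokermx G) i k.
    by rewrite mulmx_coker mxE mulr0.
  by rewrite [RHS]mxE; apply: eq_bigr => j _; rewrite [G _ _]mxE.
pose c := x *m P.
exists (\sum_i c 0 i *: e i); split; first by exists (fun i => c 0 i).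
  move=> _ [v _ <-]; rewrite Bsum -[l0]/(l : V -> R) linear_sum.
  under eq_bigr do rewrite mulr_sumr; rewrite exchange_big /=.
  apply: eq_bigr => j _; rewrite [RHS](linearZ_LR l) /=.
  transitivity ((c *m G) 0 j * v j); last by rewrite /c mulmxKpV// mxE mulrC.
  by rewrite [in RHS]mxE mulr_suml; apply: eq_bigr => i _; rewrite [G _ _]mxE mulrA.
move=> b lb; rewrite (le_trans (ler_norm_sum _ _ _))// mulr_suml.
apply: ler_sum => i _; rewrite normrZ mxE mulr_suml.
rewrite (@le_trans _ _ ((\sum_j `|x 0 j * P j i|) * `|e i|))//.
  by rewrite ler_wpM2r// ler_norm_sum.
rewrite mulr_suml ler_sum// => j _; rewrite normrM mxE.
have := lb (f j); have := normr_ge0 (P j i); have := normr_ge0 (e i).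
move: (`|P j i| : R) (`|e i| : R) => p q q0 p0 h.
rewrite [leRHS](_ : _ = b * `|f j| * p * q); last by ring.
by rewrite ler_wpM2r// ler_wpM2r.
Qed.

End normed_spaces.

(** * Quasi-best-approximation constants *)

Section qba.
Context {R : realType} {V : zmodType}.
Variables (N : V -> R) (A : set V) (P : V -> V).
Hypotheses (N_ge0 : forall v, 0 <= N v) (A_neq0 : A !=set0).

Lemma best_error_le v w : A w -> best_error N A v <= N (v - w).
Proof. by move=> Aw; apply: ge_inf; [exists 0 => _ [? _ <-]|exists w]. Qed.

Lemma best_error_ge v c : (forall w, A w -> c <= N (v - w)) -> c <= best_error N A v.
Proof.
move=> H; apply: lb_le_inf; first by have [w Aw] := A_neq0; exists (N (v - w)), w.
by move=> _ [w Aw <-]; exact: H.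
Qed.

Lemma qba_boundsP m : 1 <= m -> qba_bounds N A P m <->
  (forall v w, A w -> N (v - P v) <= m * N (v - w)).
Proof.
move=> m1; have m0 : 0 < m by rewrite (lt_le_trans _ m1).
split=> [[_ H] v w Aw|H].
  by rewrite (le_trans (H v))// ler_wpM2l ?(ltW m0)//; exact: best_error_le.
split=> // v; rewrite mulrC -ler_pdivrMr//; apply: best_error_ge => w Aw.
by rewrite ler_pdivrMr// mulrC; exact: H.
Qed.

(** As soon as one bound exists, the infimum of all bounds is itself a bound, so [xget] does not
    return its default. Where the best error vanishes, any bound forces the error to vanish;
    elsewhere one divides by the best error. *)
Lemma qba_constP : qba_bounds N A P !=set0 ->
  qba_bounds N A P (qba_const N A P) /\
  (forall m, qba_bounds N A P m -> qba_const N A P <= m).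
Proof.
move=> H; suff : exists m, qba_bounds N A P m /\ lbound (qba_bounds N A P) m.
  move=> ex; have [] := @xgetPex _ 0 _ ex; rewrite -/(qba_const N A P).
  by split.
have lb : has_lbound (qba_bounds N A P) by exists 1 => m [].
exists (inf (qba_bounds N A P)); split; last by move=> m Hm; exact: ge_inf.
split; first by apply: lb_le_inf => // m [].
move=> v; have be0 : 0 <= best_error N A v by exact: best_error_ge.
move: be0; rewrite le_eqVlt => /predU1P[be0|be0].
  by have [m [_ /(_ v)]] := H; rewrite -be0 !mulr0.
by rewrite -ler_pdivrMr//; apply: lb_le_inf => // m [_ /(_ v)]; rewrite ler_pdivrMr.
Qed.

End qba.

(** * Finite-dimensional subspaces and their products *)

Section findim.
Context {R : realType} {V : lmodType R} (A : set V) (fA : findim_subspace A).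

Lemma findim0 : A 0.
Proof.
have [n [e ->]] := fA; exists (fun=> 0) => //.
by rewrite big1// => i _; rewrite scale0r.
Qed.

Lemma findimB u v : A u -> A v -> A (u - v).
Proof.
have [n [e ->]] := fA => -[c _ <-] [d _ <-]; exists (fun i => c i - d i) => //.
by rewrite -sumrB; apply: eq_bigr => i _; rewrite scalerBl.
Qed.

Lemma findimN u : A u -> A (- u).
Proof. by move=> Au; rewrite -sub0r; apply: findimB => //; exact: findim0. Qed.

End findim.

Lemma findim_setX {R : realType} (V W : lmodType R) (A : set V) (B : set W) :
  findim_subspace A -> findim_subspace B ->
  findim_subspace (A `*` B : set (V * W)).
Proof.
move=> [n [e ->]] [m [f ->]].
exists (n + m)%N, (fun k : 'I_(n + m) =>
  match fintype.split k with inl i => (e i, 0) | inr j => (0, f j) end).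
have sumE (c : 'I_(n + m) -> R) :
    \sum_k c k *: (match fintype.split k with inl i => (e i, 0) | inr j => (0, f j) end)
    = (\sum_i c (lshift m i) *: e i, \sum_j c (rshift n j) *: f j).
  rewrite big_split_ord /= [LHS]surjective_pairing; congr (_, _).
    rewrite raddfD /= !raddf_sum /= [X in _ + X]big1 ?addr0.
      by apply: eq_bigr => i _; rewrite (unsplitK (inl i)).
    by move=> j _; rewrite (unsplitK (inr j)) /= scaler0.
  rewrite raddfD /= !raddf_sum /= [X in X + _]big1 ?add0r.
    by apply: eq_bigr => i _; rewrite (unsplitK (inr i)).
  by move=> j _; rewrite (unsplitK (inl j)) /= scaler0.
apply/seteqP; split=> [[_ _] /= [[c _ <-] [d _ <-]]|_ [c _ <-]].
  exists (fun k : 'I_(n + m) =>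
    match fintype.split k with inl i => c i | inr j => d j end) => //.
  rewrite sumE; congr (_, _); apply: eq_bigr => i _.
    by rewrite (unsplitK (inl i)).
  by rewrite (unsplitK (inr i)).
rewrite sumE; split=> /=.
  by exists (fun i => c (lshift m i)).
by exists (fun i => c (rshift n i)).
Qed.

(** * The pairing [a] as an isometric duality between [V1] and [V2] *)

Section pairing.
Context {R : realType} {V1 V2 : hilbertType R}.
Context {a : {bilinear V1 -> V2 -> R | *%R & *%R}}.
Hypothesis a_bounded : exists K : R, forall v1 v2, `|a v1 v2| <= K * `|v1| * `|v2|.
Hypothesis a_nondeg : forall v1, (forall v2, a v1 v2 = 0) -> v1 = 0.
Hypothesis norm_V2 : forall v2 : V2,
     `|v2| = sup [set a phi1 v2 | phi1 in unit_sphere V1].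

Let aZl c v1 v2 : a (c *: v1) v2 = c * a v1 v2.
Proof. by rewrite linearZl_LR. Qed.

(** The norm of [V2] is chosen to make the continuity constant 1; [a_bounded] makes the supremum in
    [norm_V2] finite, so that it dominates each of its terms. *)
Lemma pairing_le v1 v2 : `|a v1 v2| <= `|v1| * `|v2|.
Proof.
have [->|v10] := eqVneq v1 0; first by rewrite linear0l !normr0 mul0r.
suff H u : `|u| = `|v1| -> a u v2 <= `|v1| * `|v2|.
  rewrite ler_norml H// andbT lerNl.
  by have := H (- v1) (normrN _); rewrite linearNl.
move=> uv; have vp : 0 < `|v1| by rewrite normr_gt0.
rewrite -ler_pdivrMl// -aZl norm_V2; apply: ub_le_sup; last first.
  exists (`|v1|^-1 *: u) => //=.
  by rewrite /unit_sphere /= normrZ normfV normr_id uv mulVf// gt_eqF.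
have [K HK] := a_bounded; exists (K * `|v2|) => _ [phi /= phi1 <-].
by rewrite (le_trans (ler_norm _))// (le_trans (HK _ _))// phi1 mulr1.
Qed.

(** The Riesz map [A] sending [v2] to the representative of [a _ v2] is additive and, by the choice
    of the norm of [V2], norm-preserving. It therefore preserves inner products, and [w1 = A v2]
    satisfies both identities. *)
Lemma pairing_riesz2 v2 :
  exists w1, [/\ `|w1| = `|v2|, forall phi, a w1 phi = inner v2 phi &
    forall phi, inner w1 phi = a phi v2].
Proof.
have /choice[A AE] : forall v2, exists x, forall phi, inner x phi = a phi v2.
  move=> w; apply: (@riesz _ _ (a^~ w)).
    by move=> c x y; rewrite linearDl /= aZl.
  by exists `|w| => x; rewrite mulrC; exact: pairing_le.
have normA w : `|A w| = `|w|.
  apply/eqP; rewrite eq_le; apply/andP; split.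
    have [->|Aw0] := eqVneq (A w) 0; first by rewrite normr0.
    rewrite -(ler_pM2l (_ : 0 < `|A w|)) ?normr_gt0// -expr2 -inner_normE AE.
    by rewrite (le_trans (ler_norm _))// pairing_le.
  rewrite norm_V2.
  (* When [V1] is trivial the unit sphere is empty and the supremum has its default value 0. *)
  have [->|/set0P ne] := eqVneq [set a phi w | phi in unit_sphere V1] set0.
    by rewrite sup0.
  apply: ge_sup => // _ [phi /= phi1 <-]; rewrite -AE.
  by rewrite (le_trans (ler_norm _))// (le_trans (inner_le_norm _ _))// phi1 mulr1.
have AD x y : A (x + y) = A x + A y.
  by apply: inner_eqP => z; rewrite linearDl /= !AE linearDr.
exists (A v2); split=> // phi; rewrite -AE.
(* Polarization: compare the expansions of [|A phi + A v2|^2] and [|phi + v2|^2]. *)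
have := sqr_normD (A phi) (A v2); rewrite -AD !normA sqr_normD innerC.
lra.
Qed.

(** Surjectivity of the isometry behind [pairing_riesz2]: if [w] represents [a v1] in [V2], then the
    image [u] of [w] satisfies [a u = a v1], and nondegeneracy gives [u = v1]. *)
Lemma pairing_riesz1 v1 :
  exists2 w2, `|w2| = `|v1| & forall phi, a phi w2 = inner v1 phi.
Proof.
have [w wE] : exists x, forall phi, inner x phi = a v1 phi.
  apply: (@riesz _ _ (a v1)).
    by move=> c x y; rewrite linearDr /= linearZr_LR.
  by exists `|v1| => x; exact: pairing_le.
have [u [uw uE uE']] := pairing_riesz2 w.
have uv : u = v1.
  apply/eqP; rewrite -subr_eq0; apply/eqP/a_nondeg => z.
  by rewrite linearBl /= uE wE subrr.
exists w; first by rewrite -uw uv.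
by move=> phi; rewrite -uE' uv.
Qed.

End pairing.

(** * The Ritz projection, its constant [mu], and the adjoint projection *)

Section ritz.
Context {R : realType} {V1 V2 : hilbertType R}.
Context {a : {bilinear V1 -> V2 -> R | *%R & *%R}}.
Hypothesis a_bounded : exists K : R, forall v1 v2, `|a v1 v2| <= K * `|v1| * `|v2|.
Hypothesis a_nondeg : forall v1, (forall v2, a v1 v2 = 0) -> v1 = 0.
Hypothesis norm_V2 : forall v2 : V2,
     `|v2| = sup [set a phi1 v2 | phi1 in unit_sphere V1].
Context {A1 : set V1} {A2 : set V2}.
Hypotheses (A1_findim : findim_subspace A1) (A2_findim : findim_subspace A2).
Hypothesis a_nondeg_h : nondegenerate_on a A1 A2.

Let mu : R := mu_const a A1 A2.

Let a_scalarl v2 : scalar (a^~ v2).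
Proof. by move=> c x y; rewrite linearDl /= linearZl_LR. Qed.

Let a_scalarr v1 : scalar (a v1).
Proof. by move=> c x y; rewrite linearDr /= linearZr_LR. Qed.

(** The constant [K] is purely qualitative; it shows that the projection exists and that some
    quasi-best-approximation bound is finite. *)
Lemma ritz1_bound : exists2 K, 0 <= K & forall v, exists u,
  [/\ A1 u, forall phi, A2 phi -> a u phi = a v phi & `|u| <= K * `|v|].
Proof.
have [K K0 HK] := findim_solve a a_scalarl a_scalarr A1_findim A2_findim a_nondeg_h.2.
exists K => // v; have [u [Au ua ub]] := HK (a v) (a_scalarr v).
by exists u; split=> //; apply: ub => w; exact: (pairing_le a_bounded norm_V2).
Qed.

Lemma ritz1P v : A1 (ritz1 a A1 A2 v) /\
  forall phi, A2 phi -> a (ritz1 a A1 A2 v) phi = a v phi.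
Proof.
have [K _ /(_ v)[u [Au ua _]]] := ritz1_bound.
by have := @xgetPex _ 0 _ (ex_intro [set r | A1 r /\
  forall phi2, A2 phi2 -> a r phi2 = a v phi2] u (conj Au ua)).
Qed.

Lemma ritz1_unique v u : A1 u -> (forall phi, A2 phi -> a u phi = a v phi) ->
  u = ritz1 a A1 A2 v.
Proof.
move=> Au ua; have [Ar ra] := ritz1P v; apply/eqP; rewrite -subr_eq0; apply/eqP.
apply: a_nondeg_h.1; first exact: findimB.
by move=> phi Aphi; rewrite linearBl /= ua// ra// subrr.
Qed.

Let mu_spec : qba_bounds Num.norm A1 (ritz1 a A1 A2) mu /\
  (forall m, qba_bounds Num.norm A1 (ritz1 a A1 A2) m -> mu <= m).
Proof.
apply: qba_constP; [by []|by exists 0; exact: findim0|].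
have [K K0 HK] := ritz1_bound; exists (1 + K); apply/qba_boundsP => //.
- by exists 0; exact: findim0.
- by rewrite lerDl.
move=> v w Aw; have [u [Au ua ub]] := HK (v - w).
(* The Ritz projection reproduces [A1], so adding [w] to the projection [u] of [v - w] gives that of
   [v]; the error is then at most [(1 + K) |v - w|]. *)
have <- : u + w = ritz1 a A1 A2 v.
  apply: ritz1_unique => [|phi Aphi].
    by rewrite -[w]opprK; apply: findimB => //; exact: findimN.
  by rewrite linearDl /= ua// linearBl /= subrK.
by rewrite opprD addrCA addrC (le_trans (ler_normB _ _))// mulrDl mul1r lerD.
Qed.

Lemma mu_ge1 : 1 <= mu. Proof. by have [[]] := mu_spec. Qed.

Lemma ritz1_error v w : A1 w -> `|v - ritz1 a A1 A2 v| <= mu * `|v - w|.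
Proof.
have [mu_bnd _] := mu_spec.
by move: mu_bnd => /qba_boundsP; apply => //; [exists 0; exact: findim0|exact: mu_ge1].
Qed.

Lemma mu_le m : 1 <= m ->
  (forall v w, A1 w -> `|v - ritz1 a A1 A2 v| <= m * `|v - w|) -> mu <= m.
Proof.
move=> m1 H; apply: mu_spec.2; apply/qba_boundsP => //.
by exists 0; exact: findim0.
Qed.

Lemma ritz1_norm v : `|ritz1 a A1 A2 v| <= (1 + mu) * `|v|.
Proof.
have -> : ritz1 a A1 A2 v = v - (v - ritz1 a A1 A2 v) by rewrite subKr.
rewrite (le_trans (ler_normB _ _))// mulrDl mul1r lerD//.
by have := @ritz1_error v 0; rewrite subr0; apply; exact: findim0.
Qed.

(* The adjoint Ritz projection inherits the constant mu because the error
   operators of the two projections are adjoint to each other through [a]. *)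
Lemma ritz2 v : exists r, [/\ A2 r, forall phi, A1 phi -> a phi r = a phi v &
  forall w, A2 w -> `|v - r| <= mu * `|v - w|].
Proof.
have [K _ HK] := findim_solve (fun v2 v1 => a v1 v2)
  a_scalarr a_scalarl A2_findim A1_findim a_nondeg_h.1.
have [r [Ar ra _]] := HK (a^~ v) (a_scalarl v).
exists r; split=> // w Aw; set x := v - r.
have [phi [phix phiE _]] := pairing_riesz2 a_bounded norm_V2 x.
have [x0|x0] := eqVneq x 0.
  by rewrite x0 normr0 mulr_ge0// (le_trans _ mu_ge1).
have [ARphi Rphi] := ritz1P phi.
rewrite -(ler_pM2l (_ : 0 < `|x|)) ?normr_gt0// -expr2 -inner_normE -phiE.
(* Both orthogonalities enter: [v - r] is annihilated by [A1] and [phi - ritz1 a A1 A2 phi]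
   annihilates [A2]. *)
have -> : a phi x = a (phi - ritz1 a A1 A2 phi) (v - w).
  rewrite linearBl /= !linearBr /= -(ra _ ARphi) (Rphi w)// (Rphi r)//; ring.
rewrite (le_trans (ler_norm _))// (le_trans (pairing_le a_bounded norm_V2 _ _))//.
rewrite mulrA ler_wpM2r// mulrC -phix.
by have := @ritz1_error phi 0; rewrite subr0; apply; exact: findim0.
Qed.

End ritz.

(** * Finite families of eventual properties, and operator norms restricted to a subset *)

Lemma near_all_seq {T : Type} {I : eqType} (F : set_system T) {FF : Filter F}
    (P : I -> T -> Prop) (s : seq I) :
  (forall i, \forall x \near F, P i x) ->
  \forall x \near F, forall i, i \in s -> P i x.
Proof.
move=> H; elim: s => [|i s IH]; first by near=> x.
near=> x => j; rewrite inE => /predU1P[->|]; first by near: x.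
by move: j; near: x.
Unshelve. all: by end_near. Qed.

Section restricted_opnorm.
Context {R : realType} {V W : normedModType R}.

(** Extension by 0 outside [S] reduces the restricted norm to [opnorm]; for a linear [f] it behaves
    as a norm bound on sets [S] stable under scaling, such as annihilators. *)
Definition opnorm_on (S : set V) (f : V -> W) : R := opnorm (patch (fun=> 0) S f).

Lemma opnorm_on_le S f c : 0 <= c ->
  (forall x, S x -> `|x| <= 1 -> `|f x| <= c) -> opnorm_on S f <= c.
Proof.
move=> c0 H; apply: opnorm_le => x x1; rewrite /patch.
by case: ifPn => [/set_mem Sx|_]; [exact: H|rewrite normr0].
Qed.

Let bounded_patch S (f : V -> W) : bounded_op f -> bounded_op (patch (fun=> 0) S f).
Proof.
move=> [K fK]; exists (Num.max K 0) => x; rewrite /patch; case: ifPn => _.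
  by rewrite (le_trans (fK x))// ler_wpM2r// le_max lexx.
by rewrite normr0 mulr_ge0// le_max lexx orbT.
Qed.

Lemma opnorm_on_ge0 S (f : V -> W) : bounded_op f -> 0 <= opnorm_on S f.
Proof. by move=> bf; apply: opnorm_ge0; exact: bounded_patch. Qed.

Lemma opnorm_on_bound S (f : V -> W) : scalable f -> bounded_op f ->
  (forall c x, S x -> S (c *: x)) ->
  forall x, S x -> `|f x| <= opnorm_on S f * `|x|.
Proof.
move=> fZ bf SZ x Sx; have [->|x0] := eqVneq x 0.
  by rewrite -[X in f X](scale0r 0) fZ scale0r !normr0 mulr0.
have xp : 0 < `|x| by rewrite normr_gt0.
have : `|patch (fun=> 0) S f (`|x|^-1 *: x)| <= opnorm_on S f.
  apply: opnorm_ge; first exact: bounded_patch.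
  by rewrite normrZ normfV normr_id mulVf// gt_eqF.
rewrite /patch mem_set; last exact: SZ.
by rewrite fZ normrZ normfV normr_id mulrC ler_pdivrMr.
Qed.

End restricted_opnorm.

(** * Linearity and boundedness of the adjoint of [C] *)

Section adjoint.
Context {R : realType} {Q V : hilbertType R}.
Context {C : {linear Q -> dual V}} {Cs : V -> Q}.
Hypothesis C_bounded : bounded_op C.
Hypothesis Cs_adjoint : forall q v, inner q (Cs v) = C q v.

(** [Cs] is a bare function; its linearity is inherited from that of each functional [C q] through
    the adjoint identity. *)
Lemma adjointD v w : Cs (v + w) = Cs v + Cs w.
Proof.
apply: inner_eqP => q; rewrite innerC linearDl /= [inner (Cs v) q]innerC.
rewrite [inner (Cs w) q]innerC !Cs_adjoint.
by have := dual_scalar (C q) 1 v w; rewrite scale1r mul1r.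
Qed.

Lemma adjointZ : scalable Cs.
Proof.
move=> c v; apply: inner_eqP => q; rewrite innerC innerZl [inner (Cs v) q]innerC.
rewrite !Cs_adjoint.
have Cs0 : Cs 0 = 0.
  by apply: (@addrI _ (Cs 0)); rewrite -adjointD !addr0.
have C0 : C q 0 = 0 by rewrite -Cs_adjoint Cs0 linear0r.
by have := dual_scalar (C q) c v 0; rewrite C0 !addr0.
Qed.

(** Test the adjoint identity with [q = Cs v], which gives [|Cs v|^2 = C (Cs v) v], and cancel one
    factor. *)
Lemma adjoint_bound v : `|Cs v| <= opnorm C * `|v|.
Proof.
have [->|v0] := eqVneq (Cs v) 0.
  by rewrite normr0 mulr_ge0//; exact: opnorm_ge0.
rewrite -(ler_pM2l (_ : 0 < `|Cs v|)) ?normr_gt0// -expr2 -inner_normE Cs_adjoint.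
rewrite (le_trans (ler_norm _))// (le_trans (dual_bound _ _))// mulrA ler_wpM2r//.
by rewrite mulrC; apply: opnorm_bound => // c x; rewrite linearZ.
Qed.

Lemma adjoint_bounded : bounded_op Cs.
Proof. by exists (opnorm C) => v; exact: adjoint_bound. Qed.

End adjoint.

(** * Annihilators of the discrete spaces, where the Ritz errors live, and the smallness of compact
    operators on them *)

Definition annih1 {R : nmodType} {V1 V2 : Type} (a : V1 -> V2 -> R) (A2 : set V2) :
  set V1 := [set r | forall phi, A2 phi -> a r phi = 0].

Definition annih2 {R : nmodType} {V1 V2 : Type} (a : V1 -> V2 -> R) (A1 : set V1) :
  set V2 := [set r | forall phi, A1 phi -> a phi r = 0].

Section compact_operators.
Context {R : realType} {Q W V1 V2 : hilbertType R}.
Context {a : {bilinear V1 -> V2 -> R | *%R & *%R}}.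
Hypothesis a_bounded : exists K : R, forall v1 v2, `|a v1 v2| <= K * `|v1| * `|v2|.
Hypothesis a_nondeg : forall v1, (forall v2, a v1 v2 = 0) -> v1 = 0.
Hypothesis norm_V2 : forall v2 : V2,
     `|v2| = sup [set a phi1 v2 | phi1 in unit_sphere V1].

Definition asymptotically_dense {V : normedModType R} (A : nat -> set V) :=
  forall z (e : R), 0 < e -> \forall n \near \oo, exists2 w, A n w & `|z - w| <= e.

Let unit_ball_bounded (V : normedModType R) : bounded_set [set x : V | `|x| <= 1].
Proof. by exists 1; split => // M M1 x /= x1; rewrite (le_trans x1)// ltW. Qed.

(** For [w] in a finite net of the image of the unit ball, write [<w, I r>] as [a r z] and
    approximate [z] by some [z'] in [A2 n]. Since [r] annihilates [z'],
    [|I r|^2 = <I r - w, I r> + a r (z - z')], with both terms small. Finiteness of the net makes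
    [n] uniform in [r]. *)
Lemma compact_annih1 (I : {linear V1 -> W}) (A2 : nat -> set V2) (e : R) :
  bounded_op I -> compact_op I -> asymptotically_dense A2 -> 0 < e ->
  \forall n \near \oo, opnorm_on (annih1 a (A2 n)) I <= e.
Proof.
move=> bI cI dA e0; have M0 : 0 <= opnorm I by exact: opnorm_ge0.
(* The mesh of the net is chosen so that [d] times the norm of [I] is at most [e^2 / 2], also when
   that norm is 0. *)
pose d := e ^+ 2 / 2 / (opnorm I + 1).
have e20 : 0 < e ^+ 2 / 2 by rewrite divr_gt0// exprn_gt0.
have d0 : 0 < d by rewrite divr_gt0// ltr_wpDl.
have dM : d * opnorm I <= e ^+ 2 / 2.
  by rewrite /d -mulrA ler_piMr ?(ltW e20)// mulrC ler_pdivrMr ?mul1r ?lerDl// ltr_wpDl.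
have [s sP] := precompact_net _ (cI _ (unit_ball_bounded V1)) d0.
have zP w : exists z, forall r, a r z = inner w (I r).
  have [y yE] : exists y, forall r, inner y r = inner w (I r).
    apply: (@riesz _ _ (fun r => inner w (I r))).
      by move=> c u v; rewrite linearD linearZ /= linearDr /= innerZr.
    exists (`|w| * opnorm I) => r; rewrite (le_trans (inner_le_norm _ _))// -mulrA.
    by rewrite ler_wpM2l//; apply: opnorm_bound => // c u; rewrite linearZ.
  have [z _ zE] := pairing_riesz1 a_bounded a_nondeg norm_V2 y.
  by exists z => r; rewrite zE.
pose P w n := exists z z',
  [/\ forall r, a r z = inner w (I r), A2 n z' & `|z - z'| <= e ^+ 2 / 2].
have nearP w : \forall n \near \oo, P w n.
  have [z zE] := zP w; apply: filterS (dA z _ e20) => n [z' Az' zz'].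
  by exists z, z'.
apply: filterS (@near_all_seq _ _ _ _ P s nearP) => n H.
  apply: opnorm_on_le; first exact: ltW.
  move=> r Ar r1; have [w ws Irw] := sP (I r) (ex_intro2 _ _ r r1 erefl).
  have [z [z' [zE Az' zz']]] := H w ws.
  rewrite -(@ler_pXn2r _ 2)// ?nnegrE ?(ltW e0)// -inner_normE.
  have -> : inner (I r) (I r) = inner (I r - w) (I r) + a r (z - z').
    by rewrite linearBr /= (Ar z')// zE linearBl /=; ring.
  rewrite [leRHS]splitr lerD//.
    rewrite (le_trans (ler_norm _))// (le_trans (inner_le_norm _ _))//.
    rewrite (le_trans _ dM)// ler_pM// ?(ltW Irw)//; exact: opnorm_ge.
  rewrite (le_trans (ler_norm _))// (le_trans (pairing_le a_bounded norm_V2 _ _))//.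
  by rewrite (le_trans _ zz')// ler_piMl.
Qed.

(** Same scheme, but the net lives in the dual space and uses the compactness of [C] itself, not
    that of its adjoint: [|Cs r|] is a value [C q r] with [|q| <= 1], so the accuracy is [e / 2] and
    no square appears. *)
Lemma compact_annih2 (C : {linear Q -> dual V2}) (Cs : V2 -> Q)
    (A1 : nat -> set V1) (e : R) :
  compact_op C -> (forall q v, inner q (Cs v) = C q v) ->
  asymptotically_dense A1 -> 0 < e ->
  \forall n \near \oo, opnorm_on (annih2 a (A1 n)) Cs <= e.
Proof.
move=> cC Cs_adj dA e0; have e20 : 0 < e / 2 by rewrite divr_gt0.
have [s sP] := precompact_net _ (cC _ (unit_ball_bounded Q)) e20.
have zP (f : dual V2) : exists z, forall r, a z r = f r.
  have [y yE] := riesz (dual_scalar f) (dual_bounded f).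
  have [z [_ zE _]] := pairing_riesz2 a_bounded norm_V2 y.
  by exists z => r; rewrite zE.
pose P (f : dual V2) n := exists z z',
  [/\ forall r, a z r = f r, A1 n z' & `|z - z'| <= e / 2].
have nearP f : \forall n \near \oo, P f n.
  have [z zE] := zP f; apply: filterS (dA z _ e20) => n [z' Az' zz'].
  by exists z, z'.
apply: filterS (@near_all_seq _ _ _ _ P s nearP) => n H.
  apply: opnorm_on_le; first exact: ltW.
  move=> r Ar r1; have [->|q0] := eqVneq (Cs r) 0; first by rewrite normr0 ltW.
  have qp : 0 < `|Cs r| by rewrite normr_gt0.
  pose q := `|Cs r|^-1 *: Cs r.
  have q1 : `|q| <= 1 by rewrite normrZ normfV normr_id mulVf// gt_eqF.
  have -> : `|Cs r| = C q r.
    by rewrite -Cs_adj innerZl inner_normE expr2 mulKf// gt_eqF.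
  have [f fs Cqf] := sP (C q) (ex_intro2 _ _ q q1 erefl).
  have [z [z' [zE Az' zz']]] := H f fs.
  have -> : C q r = (C q - f) r + a (z - z') r.
    have -> : (C q - f) r = C q r - f r by [].
    by rewrite linearBl /= (Ar z')// zE subr0 subrK.
  rewrite (le_trans (ler_norm _))// (le_trans (ler_normD _ _))// [leRHS]splitr lerD//.
    rewrite (le_trans (dual_bound _ _))// (le_trans _ (ltW Cqf))// ler_piMr//.
  rewrite (le_trans (pairing_le a_bounded norm_V2 _ _))//.
  by rewrite (le_trans _ zz')// ler_piMr.
Qed.

End compact_operators.

(** * The Hilbert norm on the product space *)

Section prod_norm.
Context {R : realType} {V1 V2 : hilbertType R}.
Implicit Types v w : V1 * V2.

Lemma prod_norm_ge0 v : 0 <= prod_norm v. Proof. exact: sqrtr_ge0. Qed.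

Lemma sqr_prod_norm v : prod_norm v ^+ 2 = `|v.1| ^+ 2 + `|v.2| ^+ 2.
Proof. by rewrite sqr_sqrtr// addr_ge0// exprn_ge0. Qed.

Lemma prod_norm_le v c : 0 <= c -> `|v.1| ^+ 2 + `|v.2| ^+ 2 <= c ^+ 2 ->
  prod_norm v <= c.
Proof.
by move=> c0 H; rewrite -(@ler_pXn2r _ 2)// ?nnegrE ?prod_norm_ge0// sqr_prod_norm.
Qed.

Lemma norm1_le_prod v : `|v.1| <= prod_norm v.
Proof.
rewrite -(@ler_pXn2r _ 2)// ?nnegrE ?prod_norm_ge0// sqr_prod_norm.
by rewrite lerDl exprn_ge0.
Qed.

Lemma norm2_le_prod v : `|v.2| <= prod_norm v.
Proof.
rewrite -(@ler_pXn2r _ 2)// ?nnegrE ?prod_norm_ge0// sqr_prod_norm.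
by rewrite lerDr exprn_ge0.
Qed.

Lemma prod_norm_le_add v : prod_norm v <= `|v.1| + `|v.2|.
Proof.
apply: prod_norm_le; first by rewrite addr_ge0.
have := mulr_ge0 (normr_ge0 v.1) (normr_ge0 v.2); rewrite sqrrD; lra.
Qed.

Lemma prod_normN v : prod_norm (- v) = prod_norm v.
Proof. by rewrite /prod_norm /= !normrN. Qed.

Lemma prod_norm_inl (v1 : V1) : prod_norm (v1, 0 : V2) = `|v1|.
Proof. by rewrite /prod_norm /= normr0 expr0n addr0 sqrtr_sqr normr_id. Qed.

Lemma prod_normD v w : prod_norm (v + w) <= prod_norm v + prod_norm w.
Proof.
apply: prod_norm_le; first by rewrite addr_ge0// prod_norm_ge0.
have h1 : `|(v + w).1| ^+ 2 <= (`|v.1| + `|w.1|) ^+ 2.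
  by rewrite ler_pXn2r// ?nnegrE ?addr_ge0//; exact: ler_normD.
have h2 : `|(v + w).2| ^+ 2 <= (`|v.2| + `|w.2|) ^+ 2.
  by rewrite ler_pXn2r// ?nnegrE ?addr_ge0//; exact: ler_normD.
rewrite (le_trans (lerD h1 h2))// !sqrrD !sqr_prod_norm.
suff : `|v.1| * `|w.1| + `|v.2| * `|w.2| <= prod_norm v * prod_norm w by lra.
rewrite -(@ler_pXn2r _ 2)// ?nnegrE ?addr_ge0 ?mulr_ge0 ?prod_norm_ge0//.
rewrite [leRHS]exprMn !sqr_prod_norm.
(* By Lagrange's identity this square is the gap in the Cauchy-Schwarz inequality in the plane. *)
have := sqr_ge0 (`|v.1| * `|w.2| - `|v.2| * `|w.1|).
move: (`|v.1| : R) (`|v.2| : R) (`|w.1| : R) (`|w.2| : R) => p q p' q'; nra.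
Qed.

End prod_norm.

(** * The saddle point form and the error of its Galerkin approximation *)

Section galerkin_error.
Context {R : realType} {Q W V1 V2 : hilbertType R}.
Context {a : {bilinear V1 -> V2 -> R | *%R & *%R}}.
Hypothesis a_bounded : exists K : R, forall v1 v2, `|a v1 v2| <= K * `|v1| * `|v2|.
Hypothesis a_nondeg : forall v1, (forall v2, a v1 v2 = 0) -> v1 = 0.
Hypothesis norm_V2 : forall v2 : V2,
     `|v2| = sup [set a phi1 v2 | phi1 in unit_sphere V1].
Context {C : {linear Q -> dual V2}} {I : {linear V1 -> W}} {Cs : V2 -> Q}.
Hypotheses (C_bounded : bounded_op C) (I_bounded : bounded_op I).
Hypothesis Cs_adjoint : forall q v2, inner q (Cs v2) = C q v2.
Context {A1 : set V1} {A2 : set V2}.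
Hypotheses (A1_findim : findim_subspace A1) (A2_findim : findim_subspace A2).
Hypothesis a_nondeg_h : nondegenerate_on a A1 A2.
Context {alpha : R}.
Hypothesis alpha_gt0 : 0 < alpha.

Let M : R := Num.max (opnorm I) (opnorm C).
Let mu : R := mu_const a A1 A2.
Let eps : R := opnorm_on (annih1 a A2) I + opnorm_on (annih2 a A1) Cs.
Let s : R := (Num.sqrt alpha)^-1.
Let b := saddle_form a Cs I alpha.
Let G := galerkin b (A1 `*` A2).

Let s_gt0 : 0 < s. Proof. by rewrite invr_gt0 sqrtr_gt0. Qed.

Let M_ge0 : 0 <= M. Proof. by rewrite le_max opnorm_ge0. Qed.

Let I_le v : `|I v| <= M * `|v|.
Proof.
rewrite (@le_trans _ _ (opnorm I * `|v|))//; last by rewrite ler_wpM2r// le_max lexx.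
by apply: opnorm_bound => // c x; rewrite linearZ.
Qed.

Let Cs_le v : `|Cs v| <= M * `|v|.
Proof.
rewrite (@le_trans _ _ (opnorm C * `|v|))//; first exact: adjoint_bound.
by rewrite ler_wpM2r// le_max lexx orbT.
Qed.

Lemma saddle_formC v phi : b v phi = b phi v.
Proof. by rewrite /b /saddle_form (innerC (Cs _)) (innerC (I _)) (addrC (a _ _)). Qed.

Lemma saddle_form_scalarl phi : scalar (b^~ phi).
Proof.
move=> c x y; rewrite /b /saddle_form /= !(linearDl, linearDr) /=.
rewrite linearZl_LR linearZr_LR /=.
rewrite !(adjointD Cs_adjoint) !(adjointZ Cs_adjoint) linearD linearZ /=.
rewrite !linearDl /= !innerZl; ring.
Qed.

Lemma saddle_form_scalarr v : scalar (b v).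
Proof. by move=> c x y; rewrite !(saddle_formC v) saddle_form_scalarl. Qed.

Let Cs0 : Cs 0 = 0.
Proof. by rewrite -(scale0r (0 : V2)) (adjointZ Cs_adjoint) scale0r. Qed.

Lemma saddle_form_inl v phi1 :
  b v (phi1, 0) = a phi1 v.2 - s * inner (I v.1) (I phi1).
Proof. by rewrite /b /saddle_form /= Cs0 !linear0r /= add0r sub0r mulrN. Qed.

Lemma saddle_form_inr v phi2 :
  b v (0, phi2) = a v.1 phi2 + s * inner (Cs v.2) (Cs phi2).
Proof.
by rewrite /b /saddle_form /= linear0 linear0r linear0l /= addr0 subr0.
Qed.

(** With [v = phi] the two [a] terms cancel and the indefinite form leaves [s] times a sum of
    squares. *)
Lemma saddle_form_flip v phi :
  b v (- phi.1, phi.2) = a v.1 phi.2 - a phi.1 v.2 +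
    s * (inner (Cs v.2) (Cs phi.2) + inner (I v.1) (I phi.1)).
Proof.
by rewrite /b /saddle_form /= linearN linearNl linearNr /= opprK.
Qed.

Let A12_findim : findim_subspace (A1 `*` A2).
Proof. exact: findim_setX. Qed.

(** It suffices that [b] is nondegenerate on the discrete space. Testing a kernel element with its
    own flip gives [Cs phi.2 = 0] and [I phi.1 = 0]; what remains of [b] is [a], which is
    nondegenerate there. *)
Lemma galerkinP v : (A1 `*` A2) (G v) /\
  forall phi, (A1 `*` A2) phi -> b (G v) phi = b v phi.
Proof.
have nd phi : (A1 `*` A2) phi -> (forall u, (A1 `*` A2) u -> b u phi = 0) -> phi = 0.
  move=> [Aphi1 Aphi2] H.
  have : b phi (- phi.1, phi.2) = 0.
    by rewrite saddle_formC; apply: H; split => //=; exact: findimN.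
  rewrite saddle_form_flip subrr add0r !inner_normE => /eqP.
  rewrite mulf_eq0 gt_eqF//= paddr_eq0 ?exprn_ge0// !sqrf_eq0 !normr_eq0.
  move=> /andP[/eqP C0 /eqP I0].
  rewrite [phi]surjective_pairing; congr (_, _).
    apply: a_nondeg_h.1 => // w Aw.
    have := H (0, w); rewrite saddle_formC saddle_form_inr C0 linear0l mulr0 addr0.
    by apply; split => //=; exact: findim0.
  apply: a_nondeg_h.2 => // w Aw.
  have := H (w, 0); rewrite saddle_formC saddle_form_inl I0 linear0l mulr0 subr0.
  by apply; split => //=; exact: findim0.
have [K _ HK] := findim_solve b saddle_form_scalarl saddle_form_scalarr
  A12_findim A12_findim nd.
have [u [Au ub _]] := HK (b v) (saddle_form_scalarr v).
by have := @xgetPex _ (0, 0) _ (ex_intro [set g | (A1 `*` A2) g /\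
  forall phi, (A1 `*` A2) phi -> b g phi = b v phi] u (conj Au ub)).
Qed.

Let mu1 : 1 <= mu. Proof. exact: (mu_ge1 a_bounded norm_V2). Qed.

Let eps_ge0 : 0 <= eps.
Proof.
by rewrite addr_ge0// opnorm_on_ge0//; exact: (adjoint_bounded C_bounded Cs_adjoint).
Qed.

Let ritz_error_small r : annih1 a A2 r.1 -> annih2 a A1 r.2 ->
  `|I r.1| + `|Cs r.2| <= eps * prod_norm r.
Proof.
move=> r1 r2; rewrite /eps mulrDl lerD//.
  have h := @opnorm_on_bound _ _ _ (annih1 a A2) I.
  rewrite (le_trans (h _ _ _ _ r1))//.
  - by move=> c x; rewrite linearZ.
  - by move=> c x Sx phi Aphi; rewrite linearZl_LR Sx// mulr0.
  - by rewrite ler_wpM2l ?opnorm_on_ge0//; exact: norm1_le_prod.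
have h := @opnorm_on_bound _ _ _ (annih2 a A1) Cs.
rewrite (le_trans (h _ _ _ _ r2))//.
- exact: (adjointZ Cs_adjoint).
- exact: (adjoint_bounded C_bounded Cs_adjoint).
- by move=> c x Sx phi Aphi; rewrite linearZr_LR Sx// mulr0.
- rewrite ler_wpM2l ?opnorm_on_ge0//; last exact: norm2_le_prod.
  exact: (adjoint_bounded C_bounded Cs_adjoint).
Qed.

Let delta : R := 4 * s * M * (1 + mu) * eps.

Let delta_ge0 : 0 <= delta.
Proof. by rewrite !mulr_ge0// ?(ltW s_gt0)// addr_ge0// (le_trans _ mu1). Qed.

Let le_of_sqr (x c : R) : 0 <= c -> x ^+ 2 <= c * x -> x <= c.
Proof.
move=> c0; have [x0|x0] := leP x 0; first by move=> _; exact: le_trans c0.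
by rewrite expr2 ler_pM2r.
Qed.

(** The identity for [r.1] is recorded because the lower bound on the Galerkin constant needs the
    Ritz error itself, and not only its estimate. *)
Lemma galerkin_split v : exists r d, [/\ v - G v = r + d,
  r.1 = v.1 - ritz1 a A1 A2 v.1,
  forall w, (A1 `*` A2) w -> prod_norm r <= mu * prod_norm (v - w) &
  prod_norm d <= delta * prod_norm r].
Proof.
have ritz2E := ritz2 a_bounded norm_V2 A1_findim A2_findim a_nondeg_h.
have ritz1E := ritz1P a_bounded norm_V2 A1_findim A2_findim a_nondeg_h.
have [rho1A rho1E] := ritz1E v.1; have [rho2 [rho2A rho2E rho2_err]] := ritz2E v.2.
have [[G1A G2A] GE] := galerkinP v.
pose r : V1 * V2 := (v.1 - ritz1 a A1 A2 v.1, v.2 - rho2).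
pose d : V1 * V2 := (ritz1 a A1 A2 v.1 - (G v).1, rho2 - (G v).2).
have vE : v - G v = r + d.
  by rewrite [LHS]surjective_pairing /= ; congr (_, _); rewrite addrA subrK.
have r1 : annih1 a A2 r.1.
  by move=> phi Aphi; rewrite linearBl /= rho1E// subrr.
have r2 : annih2 a A1 r.2.
  by move=> phi Aphi; rewrite linearBr /= rho2E// subrr.
have d1A : A1 d.1 by exact: findimB.
have d2A : A2 d.2 by exact: findimB.
have bE phi : (A1 `*` A2) phi -> b (r + d) phi = 0.
  move=> Aphi; rewrite -vE.
  have := saddle_form_scalarl phi (-1) (G v) v.
  by rewrite scaleN1r [- G v + v]addrC GE// mulN1r addNr.
(* Galerkin orthogonality tested with one component equal to 0; the Ritz error drops out of [a]
   because it is annihilated by discrete functions. *)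
have d1E phi : A2 phi -> a d.1 phi = - (s * inner (Cs r.2 + Cs d.2) (Cs phi)).
  move=> Aphi; have := bE (0, phi) (conj (findim0 A1_findim) Aphi).
  rewrite saddle_form_inr (adjointD Cs_adjoint) linearDl /= r1// add0r.
  by move=> /eqP; rewrite addr_eq0 => /eqP.
have d2E phi : A1 phi -> a phi d.2 = s * inner (I r.1 + I d.1) (I phi).
  move=> Aphi; have := bE (phi, 0) (conj Aphi (findim0 A2_findim)).
  rewrite saddle_form_inl [I _]linearD linearDr /= r2// add0r.
  by move=> /eqP; rewrite subr_eq0 => /eqP.
pose T := `|I r.1| + `|Cs r.2|.
have T0 : 0 <= T by rewrite addr_ge0.
have TM : 0 <= 2 * s * T * M * (1 + mu).
  by rewrite !mulr_ge0// ?(ltW s_gt0)// addr_ge0// (le_trans _ mu1).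
(* The two expressions for [a d.1 d.2] give [|I d.1|^2 + |Cs d.2|^2 = - <I r.1, I d.1> - <Cs r.2, Cs
   d.2>]; Young's inequality absorbs the [d] terms of the right-hand side. *)
have stab : `|I d.1| ^+ 2 + `|Cs d.2| ^+ 2 <= T ^+ 2.
  have /eqP := d2E _ d1A; rewrite d1E// !linearDl /= !inner_normE eq_sym -subr_eq0 opprK.
  rewrite -mulrDr mulf_eq0 gt_eqF//= => /eqP.
  have := inner_le_norm (I r.1) (I d.1); have := inner_le_norm (Cs r.2) (Cs d.2).
  rewrite !ler_norml /T => /andP[+ _] /andP[+ _].
  move: (inner _ _) (inner _ _) (normr_ge0 (I r.1)) (normr_ge0 (Cs r.2)).
  move: (`|I r.1| : R) (`|Cs r.2| : R) (`|I d.1| : R) (`|Cs d.2| : R) => p q p' q' x y.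
  have := sqr_ge0 (p - p'); have := sqr_ge0 (q - q'); nra.
have Id_le : `|I d.1| <= T.
  rewrite -(@ler_pXn2r _ 2)// ?nnegrE// (le_trans _ stab)//.
  by rewrite lerDl exprn_ge0.
have Csd_le : `|Cs d.2| <= T.
  rewrite -(@ler_pXn2r _ 2)// ?nnegrE// (le_trans _ stab)//.
  by rewrite lerDr exprn_ge0.
have d1_le : `|d.1| <= 2 * s * T * M * (1 + mu).
  (* Duality: [|d.1|^2 = a d.1 w] with [|w| = |d.1|]. As [d.1] is discrete, [w] may be replaced by
     its adjoint Ritz projection [t], an admissible test function in [d1E] of norm at most
     [(1 + mu) |d.1|]. *)
  have [w [wn wE]] := pairing_riesz1 a_bounded a_nondeg norm_V2 d.1.
  have [t [tA tE t_err]] := ritz2E w.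
  have tn : `|t| <= (1 + mu) * `|d.1|.
    rewrite -[t](subKr w) (le_trans (ler_normB _ _))// mulrDl mul1r -wn lerD//.
    by have := t_err 0; rewrite subr0; apply; exact: findim0.
  apply: le_of_sqr => //.
  rewrite -inner_normE -wE -tE// d1E//.
  rewrite (le_trans (ler_norm _))// normrN normrM gtr0_norm//.
  rewrite (le_trans (ler_wpM2l (ltW s_gt0) (inner_le_norm _ _)))//.
  rewrite [leRHS](_ : _ = s * ((T + T) * (M * ((1 + mu) * `|d.1|)))); last by ring.
  rewrite ler_wpM2l ?(ltW s_gt0)// ler_pM//.
    by rewrite (le_trans (ler_normD _ _))// lerD// lerDr.
  by rewrite (le_trans (Cs_le _))// ler_wpM2l.
have d2_le : `|d.2| <= 2 * s * T * M * (1 + mu).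
  (* Mirror image of the previous bound, with the Ritz projection in place of its adjoint. *)
  have [w [wn wE _]] := pairing_riesz2 a_bounded norm_V2 d.2.
  have [tA tE] := ritz1E w.
  have tn : `|ritz1 a A1 A2 w| <= (1 + mu) * `|d.2|.
    by rewrite -wn; exact: ritz1_norm.
  apply: le_of_sqr => //.
  rewrite -inner_normE -wE -tE// d2E//.
  rewrite (le_trans (ler_norm _))// normrM gtr0_norm//.
  rewrite (le_trans (ler_wpM2l (ltW s_gt0) (inner_le_norm _ _)))//.
  rewrite [leRHS](_ : _ = s * ((T + T) * (M * ((1 + mu) * `|d.2|)))); last by ring.
  rewrite ler_wpM2l ?(ltW s_gt0)// ler_pM//.
    by rewrite (le_trans (ler_normD _ _))// lerD// lerDl.
  by rewrite (le_trans (I_le _))// ler_wpM2l.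
exists r, d; split=> //.
  move=> w [w1A w2A]; apply: prod_norm_le.
    by rewrite mulr_ge0 ?prod_norm_ge0// (le_trans _ mu1).
  rewrite exprMn sqr_prod_norm mulrDr -!exprMn lerD//.
    rewrite ler_pXn2r// ?nnegrE ?mulr_ge0 ?(le_trans _ mu1)//.
    exact: (ritz1_error a_bounded norm_V2).
  by rewrite ler_pXn2r// ?nnegrE ?mulr_ge0 ?(le_trans _ mu1)//; exact: rho2_err.
(* Each component contributes [2 s M (1 + mu) T], whence the factor 4 in [delta]. *)
rewrite (le_trans (prod_norm_le_add _))// (le_trans (lerD d1_le d2_le))//.
rewrite /delta [leLHS](_ : _ = 4 * s * M * (1 + mu) * T); last by ring.
rewrite -[leRHS]mulrA ler_wpM2l//; last exact: ritz_error_small.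
by rewrite !mulr_ge0// ?(ltW s_gt0)// addr_ge0// (le_trans _ mu1).
Qed.

(** The upper bound is [|r + d| <= (1 + delta) |r|]. For the lower bound, the pairs [(v1, 0)] and
    [(w1, 0)] reduce the product problem to the Ritz one: [|r| <= |r + d| + |d|] yields
    [mu <= nu + mu delta]. *)
Lemma nu_bounds :
  mu * (1 - delta) <= nu_const a Cs I alpha A1 A2 <= mu * (1 + delta).
Proof.
set nu := nu_const _ _ _ _ _ _; have A0 : A1 `*` A2 !=set0.
  by exists (0, 0); split; exact: findim0.
have pn0 := @prod_norm_ge0 R V1 V2.
have md1 : 1 <= mu * (1 + delta).
  by rewrite (le_trans mu1)// ler_peMr ?lerDl// (le_trans _ mu1).
have upper : qba_bounds prod_norm (A1 `*` A2) G (mu * (1 + delta)).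
  apply/qba_boundsP => // v w Aw; have [r [d [-> _ r_le d_le]]] := galerkin_split v.
  rewrite (le_trans (prod_normD _ _))// (le_trans (lerD (lexx _) d_le))//.
  rewrite -{1}[prod_norm r]mul1r -mulrDl [mu * _]mulrC -mulrA.
  by rewrite ler_wpM2l ?addr_ge0// r_le.
have [nuP nu_min] := @qba_constP _ _ _ _ G pn0 A0 (ex_intro _ _ upper).
apply/andP; split; last exact: nu_min.
have nu1 : 1 <= nu by have [] := nuP.
rewrite mulrBr mulr1 lerBlDr; apply: (mu_le a_bounded norm_V2) => //.
  by rewrite (le_trans nu1)// lerDl mulr_ge0// (le_trans _ mu1).
move=> v1 w1 Aw1.
have A12w : (A1 `*` A2) (w1, 0) by split => //=; exact: findim0.
have [r [d [E r1 r_le d_le]]] := galerkin_split (v1, 0).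
have vw : prod_norm ((v1, 0) - (w1, 0) : V1 * V2) = `|v1 - w1|.
  by rewrite -(prod_norm_inl (V2 := V2)); congr prod_norm; congr (_, _); rewrite /= subr0.
rewrite -r1 (le_trans (norm1_le_prod _))//.
have -> : r = (r + d) - d by rewrite addrK.
rewrite (le_trans (prod_normD _ _))// prod_normN -E mulrDl lerD//.
  have /qba_boundsP := nuP; rewrite -vw; apply=> //.
rewrite (le_trans d_le)// [mu * _]mulrC -[leRHS]mulrA ler_wpM2l// -vw.
exact: r_le.
Qed.

End galerkin_error.

(** The factor [(1 + 2 L) / (1 + L)] is at least 1 and the term [M mubar] is nonnegative; both are
    discarded. The remaining 1 gives positivity even if [M = 0], and the other term absorbs the
    [alpha] dependence of [delta]. *)
Lemma kappa_bar_ge (R : realType) (M mubar alpha : R) :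
  0 <= M -> 1 <= mubar -> 0 < alpha ->
  1 + 2 * M ^+ 2 / Num.sqrt alpha * mubar <= kappa_bar M mubar alpha.
Proof.
move=> M0 mubar1 alpha0; rewrite /kappa_bar.
have s0 : 0 <= (Num.sqrt alpha)^-1 by rewrite invr_ge0 sqrtr_ge0.
have mubar0 : 0 <= mubar by rewrite (le_trans _ mubar1).
set t := _^-1 in s0 *.
have L0 : 0 <= M * t by rewrite mulr_ge0.
have K0 : 0 <= M * mubar by rewrite mulr_ge0.
have K1 : 0 <= M * mubar * (M * t) by rewrite mulr_ge0.
rewrite (@le_trans _ _ (1 + M * (1 + 2 * M * t) * mubar))//.
  by lra.
rewrite ler_peMl//; first by lra.
by rewrite ler_pdivlMr; lra.
Qed.

(** * Density of each discrete component space, from approximation in the product *)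

Lemma best_error_lt_witness (R : realType) (V : zmodType) (N : V -> R)
    (A : set V) v (e : R) :
  A !=set0 -> (forall v, 0 <= N v) -> best_error N A v < e ->
  exists2 w, A w & N (v - w) < e.
Proof.
move=> [w0 Aw0] N0 ve; rewrite -subr_gt0 in ve.
have inf_N : has_inf [set N (v - w) | w in A].
  by split; [exists (N (v - w0)), w0|exists 0 => _ [w _ <-]].
have [_ [w Aw <-]] := inf_adherent ve inf_N.
by rewrite -/(best_error N A v) subrKC; exists w.
Qed.

Section approximation.
Context {R : realType} {V1 V2 : hilbertType R} {A1 : nat -> set V1} {A2 : nat -> set V2}.
Hypotheses (A1_findim : forall n, findim_subspace (A1 n))
  (A2_findim : forall n, findim_subspace (A2 n))
  (A_approx : forall v : V1 * V2,
     best_error prod_norm (A1 n `*` A2 n) v @[n --> \oo] --> 0).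

Let prod_approx (v : V1 * V2) (e : R) : 0 < e -> \forall n \near \oo,
  exists2 w, (A1 n `*` A2 n) w & prod_norm (v - w) <= e.
Proof.
move=> e0; have /cvgrPdist_lt/(_ e e0) := A_approx v; apply: filterS => n.
rewrite sub0r normrN => /(le_lt_trans (ler_norm _)) ve.
have A0 : A1 n `*` A2 n !=set0 by exists (0, 0); split; exact: findim0.
have [w Aw /ltW] := @best_error_lt_witness _ _ _ _ _ _ A0 (@prod_norm_ge0 _ _ _) ve.
by exists w.
Qed.

Lemma dense_fst : asymptotically_dense A1.
Proof.
move=> z e e0; apply: filterS (prod_approx (z, 0) e e0) => n [w [w1 _]] zw.
by exists w.1 => //; exact: le_trans (norm1_le_prod _) zw.
Qed.

Lemma dense_snd : asymptotically_dense A2.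
Proof.
move=> z e e0; apply: filterS (prod_approx (0, z) e e0) => n [w [_ w2]] zw.
by exists w.2 => //; exact: le_trans (norm2_le_prod _) zw.
Qed.

End approximation.

Theorem lemma3p6 (R : realType) (Q W V1 V2 : hilbertType R)
  (a : {bilinear V1 -> V2 -> R | *%R & *%R})
  (a_bounded : exists K : R, forall v1 v2, `|a v1 v2| <= K * `|v1| * `|v2|)
  (a_nondeg : forall v1, (forall v2, a v1 v2 = 0) -> v1 = 0)
  (a_infsup : (0 < ereal_inf
     [set ereal_sup [set (a v1 v2)%:E | v1 in unit_sphere V1]
     | v2 in unit_sphere V2])%E)
  (norm_V2 : forall v2 : V2,
     `|v2| = sup [set a phi1 v2 | phi1 in unit_sphere V1])
  (C : {linear Q -> dual V2}) (I : {linear V1 -> W})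
  (C_bounded : bounded_op C) (I_bounded : bounded_op I)
  (Cs : V2 -> Q) (Cs_adjoint : forall q v2, inner q (Cs v2) = C q v2)
  (h : nat -> R) (h_gt0 : forall n, 0 < h n) (h_cvg0 : h n @[n --> \oo] --> 0)
  (Vh1 : R -> set V1) (Vh2 : R -> set V2)
  (Vh1_findim : forall n, findim_subspace (Vh1 (h n)))
  (Vh2_findim : forall n, findim_subspace (Vh2 (h n)))
  (a_nondeg_h : forall n, nondegenerate_on a (Vh1 (h n)) (Vh2 (h n)))
  (mubar : R) (mubar_ge1 : 1 <= mubar)
  (mu_le_mubar : forall n, mu_const a (Vh1 (h n)) (Vh2 (h n)) <= mubar)
  (I_compact : compact_op I) (C_compact : compact_op C)
  (Vh_approx : forall v : V1 * V2,
     best_error prod_norm (Vh1 (h n) `*` Vh2 (h n)) v @[n --> \oo] --> 0) :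
  let M := Num.max (opnorm I) (opnorm C) in
  let mu x := mu_const a (Vh1 x) (Vh2 x) in
  let nu alpha x := nu_const a Cs I alpha (Vh1 x) (Vh2 x) in
  exists2 rate : R -> R, rate (h n) @[n --> \oo] --> 0 &
    exists o : R -> R -> R, forall alpha : R, 0 < alpha -> forall n,
      `|o alpha (h n)| <= rate (h n) /\
      nu alpha (h n)
      = mu (h n) * (1 + kappa_bar M mubar alpha * o alpha (h n)).
Proof.
move=> M mu nu.
have M0 : 0 <= M by rewrite le_max opnorm_ge0.
pose eps x := opnorm_on (annih1 a (Vh2 x)) I +
              opnorm_on (annih2 a (Vh1 x)) Cs.
have Cs_bounded := adjoint_bounded C_bounded Cs_adjoint.
have eps0 x : 0 <= eps x by rewrite addr_ge0// opnorm_on_ge0.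
(* The rate sees only [h], since [eps] does not involve [alpha]. If [M = 0], division by 0 makes the
   rate 0, which is consistent because [delta] then vanishes too. *)
exists (fun x => 4 / M * eps x).
  rewrite -[X in _ --> X](mulr0 (4 / M)); apply: cvgMl_tmp.
  apply/cvgrPdist_le => e e0; have e20 : 0 < e / 2 by rewrite divr_gt0.
  have d1 := dense_fst Vh1_findim Vh2_findim Vh_approx.
  have d2 := dense_snd Vh1_findim Vh2_findim Vh_approx.
  near=> n.
  have h1 : opnorm_on (annih1 a (Vh2 (h n))) I <= e / 2.
    by near: n; exact: (compact_annih1 a_bounded a_nondeg norm_V2).
  have h2 : opnorm_on (annih2 a (Vh1 (h n))) Cs <= e / 2.
    by near: n; exact: (compact_annih2 a_bounded norm_V2 C).
  by rewrite sub0r normrN ger0_norm// [leRHS]splitr lerD.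
(* The required identity is solved for [o], which is possible because [mu] and [kappa_bar] are
   positive; only the size of [o] remains to be bounded. *)
exists (fun alpha x => (nu alpha x / mu x - 1) / kappa_bar M mubar alpha).
move=> alpha alpha0 n.
have mu1 : 1 <= mu (h n).
  exact: (mu_ge1 a_bounded norm_V2 (Vh1_findim n) (Vh2_findim n) (a_nondeg_h n)).
have mup : 0 < mu (h n) by rewrite (lt_le_trans _ mu1).
have kge := @kappa_bar_ge _ _ _ _ M0 mubar_ge1 alpha0.
have s0 : 0 <= (Num.sqrt alpha)^-1 by rewrite invr_ge0 sqrtr_ge0.
have mubar0 : 0 <= mubar by rewrite (le_trans _ mubar_ge1).
have kp : 0 < kappa_bar M mubar alpha.
  by rewrite (lt_le_trans _ kge)// ltr_wpDr// !mulr_ge0// exprn_ge0.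
split; last by field; rewrite !gt_eqF.
have := nu_bounds a_bounded a_nondeg norm_V2 C_bounded I_bounded Cs_adjoint
  (Vh1_findim n) (Vh2_findim n) (a_nondeg_h n) alpha0.
rewrite -/(mu (h n)) -/(nu alpha (h n)) -/M -/(eps (h n)).
set delta := 4 * _ * M * _ * _ => /andP[lo up].
rewrite normrM normfV (gtr0_norm kp) ler_pdivrMr//.
(* The two-sided bound divided by [mu] says [|nu / mu - 1| <= delta]. *)
apply: (@le_trans _ _ delta).
  by rewrite ler_distl ler_pdivlMr// ler_pdivrMr// ![_ * mu _]mulrC lo.
rewrite /delta; move: M0; rewrite le_eqVlt => /predU1P[<-|Mp].
  by rewrite mulr0 !mul0r invr0 mulr0 !mul0r.
rewrite [leRHS](_ : _ = 4 / M * kappa_bar M mubar alpha * eps (h n)); last by ring.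
rewrite ler_wpM2r// [leLHS](_ : _ = 4 / M * (M ^+ 2 / Num.sqrt alpha * (1 + mu (h n))));
  last by field; rewrite !gt_eqF// sqrtr_gt0.
rewrite ler_wpM2l ?divr_ge0 ?(ltW Mp)// (le_trans _ kge)//.
have mub : mu (h n) <= mubar := mu_le_mubar n.
have t0 : 0 <= M ^+ 2 / Num.sqrt alpha by rewrite mulr_ge0// exprn_ge0// ltW.
(* Both 1 and [mu] are at most [mubar], so [1 + mu <= 2 mubar], the form in which [kappa_bar]
   dominates. *)
have : M ^+ 2 / Num.sqrt alpha * (1 + mu (h n)) <= M ^+ 2 / Num.sqrt alpha * (2 * mubar).
  by rewrite ler_wpM2l//; lra.
move=> /le_trans; apply; lra.
Unshelve. all: by end_near. Qed.
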